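(* Let $p$ be a prime, let $E$ be an elementary abelian $p$-group of order $q$, let $\Bbbk$ be a field of characteristic $p$, and let $V$ be a faithful indecomposable $\Bbbk E$-module of dimension $2$. Let $m,d$ be integers with $0\le m<q$ and $d>q$, and let $d'$ be the integer with $d'\equiv d \pmod q$ and $0\leq d'<q$. Then $S^d(S^m(V)^* )\cong S^{d'}(S^m(V)^* )$ modulo summands which are projective relative to the set $\mathcal{X}$ of subgroups of $E$ of order $\leq m$; that is, there exist $\Bbbk E$-modules $P$ and $Q$, both projective relative to $\mathcal{X}$, such that $S^d(S^m(V)^* )\oplus P\cong S^{d'}(S^m(V)^* )\oplus Q$ as $\Bbbk E$-modules.
   Context: $S^d(-)$ denotes the $d$-th symmetric power with its usual group action, and $M^*$ the dual (contragredient) module of $M$; modules are finite-dimensional. For a finite group $G$ and a set $\mathcal{X}$ of subgroups of $G$, a finitely generated $\Bbbk G$-module $M$ is projective relative to $\mathcal{X}$ if it is a direct summand of $\bigoplus_{H\in\mathcal{X}} M\downarrow_H\uparrow_H^G$, where $\downarrow_H$ is restriction to $H$ and $N\uparrow_H^G=\Bbbk G\otimes_{\Bbbk H}N$ is induction. If $\mathcal{X}$ is empty, only the zero module is projective relative to $\mathcal{X}$. *)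

(* Defs.v *)
From mathcomp Require Import all_boot all_algebra all_fingroup.
From mathcomp Require Import mxrepresentation character.
From mathcomp Require Import mpoly.

Set Implicit Arguments.
Unset Strict Implicit.
Unset Printing Implicit Defensive.

Import GroupScope GRing.Theory.
Local Open Scope ring_scope.

(* Modules over a group algebra are matrix representations acting on row      *)
(* vectors (so on the right), as in mxrepresentation; all constructions below *)
(* are stated with this handedness.                                           *)

Section SymmetricPowerMatrix.

Variables (F : fieldType) (n d : nat).
Implicit Types A B : 'M[F]_n.

Definition sym_basis : {set 'X_{1..n < d.+1}} :=
  [set m : 'X_{1..n < d.+1} | mdeg m == d].

Definition sym_mon (i : 'I_#|sym_basis|) : 'X_{1..n} :=
  (enum_val i : 'X_{1..n < d.+1}).

Definition linear_forms A : n.-tuple {mpoly F[n]} :=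
  [tuple \sum_(j < n) A i j *: 'X_j | i < n].

(* S^d(F^n) is the space of homogeneous polynomials of degree d in n          *)
(* variables, the i-th variable standing for the i-th basis row vector of     *)
(* F^n; A maps the i-th variable to the linear form given by its i-th row,    *)
(* and sym_mx A is the matrix of this substitution on the monomial basis.     *)
Definition sym_mx A : 'M[F]_#|sym_basis| :=
  \matrix_(i, j) ('X_[sym_mon i] \mPo linear_forms A)@_(sym_mon j).

Lemma linear_forms1 : linear_forms 1%:M = [tuple 'X_i | i < n].
Proof.
apply: eq_mktuple => i; rewrite (bigD1 i) //= mxE eqxx scale1r big1 ?addr0 //.
by move=> j ne_ji; rewrite mxE eq_sym (negPf ne_ji) scale0r.
Qed.

Lemma sym_mx1 : sym_mx 1%:M = 1%:M.
Proof.
apply/matrixP=> i j; rewrite !mxE linear_forms1 comp_mpoly_id mcoeffX.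
by rewrite -bmeqP (inj_eq enum_val_inj).
Qed.

Lemma linear_formsM A B (p : {mpoly F[n]}) :
  p \mPo linear_forms (A *m B) = (p \mPo linear_forms A) \mPo linear_forms B.
Proof.
rewrite (comp_mpolyEX p (linear_forms A)) (comp_mpolyEX p) raddf_sum /=.
apply: eq_bigr => m _; rewrite comp_mpolyZ; congr (_ *: _).
rewrite !comp_mpolyX rmorph_prod /=; apply: eq_bigr => i _.
rewrite rmorphXn /=; congr (_ ^+ _); rewrite !tnth_mktuple raddf_sum /=.
transitivity (\sum_(l < n) \sum_(j < n) (A i j * B j l) *: ('X_l : {mpoly F[n]})).
  by apply: eq_bigr => l _; rewrite mxE scaler_suml.
rewrite exchange_big; apply: eq_bigr => j _ /=.
rewrite comp_mpolyZ comp_mpolyXU -tnth_nth tnth_mktuple scaler_sumr.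
by apply: eq_bigr => l _; rewrite scalerA.
Qed.

Lemma homog_linear_forms A (m : 'X_{1..n}) :
  'X_[m] \mPo linear_forms A \is (mdeg m).-homog.
Proof.
rewrite comp_mpolyX mdegE.
have h (r : seq 'I_n) :
    \prod_(i <- r) tnth (linear_forms A) i ^+ m i \is
      (\sum_(i <- r) m i)%N.-homog.
  elim: r => [|i r IHr]; first by rewrite !big_nil dhomog1.
  rewrite !big_cons; apply: dhomogM IHr; rewrite -[X in X.-homog]mul1n.
  apply: dhomogMn; rewrite tnth_mktuple rpred_sum // => j _.
  by apply: rpredZ; rewrite dhomogX /= mdeg1.
exact: h.
Qed.

Lemma mdeg_sym_mon i : mdeg (sym_mon i) = d.
Proof.
have: (enum_val i : 'X_{1..n < d.+1}) \in sym_basis by apply: enum_valP.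
by rewrite inE => /eqP.
Qed.

Lemma sym_mxM A B : sym_mx (A *m B) = sym_mx A *m sym_mx B.
Proof.
apply/matrixP=> i j; rewrite !mxE linear_formsM.
have homA : 'X_[sym_mon i] \mPo linear_forms A \is d.-homog.
  by have := homog_linear_forms A (sym_mon i); rewrite mdeg_sym_mon.
have szA : (msize ('X_[sym_mon i] \mPo linear_forms A) <= d.+1)%N.
  rewrite msizeE; apply/bigmax_leqP_seq => m Am _.
  by rewrite (dhomogP _ _ _ homA m Am).
have EA : 'X_[sym_mon i] \mPo linear_forms A =
    \sum_(l < #|sym_basis|) sym_mx A i l *: 'X_[sym_mon l].
  rewrite -{1}(pihomog_dE homA) (pihomogwE _ _ szA).
  rewrite (eq_bigl (fun m => m \in sym_basis)) => [|m]; last by rewrite !inE.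
  by rewrite big_enum_val; apply: eq_bigr => l _; rewrite mxE.
rewrite EA (raddf_sum (comp_mpoly (linear_forms B))) /= raddf_sum /=; apply: eq_bigr => l _ /=.
by rewrite comp_mpolyZ mcoeffZ !mxE.
Qed.

End SymmetricPowerMatrix.

Section Constructions.

Variables (F : fieldType) (gT : finGroupType) (G : {group gT}).

Lemma sym_mx_repr n (rG : mx_representation F G n) d :
  mx_repr G (fun g => sym_mx d (rG g)).
Proof.
by split=> [|x y Gx Gy]; rewrite ?repr_mx1 ?sym_mx1 // repr_mxM // sym_mxM.
Qed.

Definition sym_repr n (rG : mx_representation F G n) d :=
  MxRepresentation (sym_mx_repr rG d).

Lemma dual_mx_repr n (rG : mx_representation F G n) :
  mx_repr G (fun g => (rG g^-1%g)^T).
Proof.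
split=> [|x y Gx Gy]; first by rewrite invg1 repr_mx1 trmx1.
by rewrite invMg repr_mxM ?groupV // trmx_mul.
Qed.

(* Row vectors are coordinates with respect to the dual basis: the formula    *)
(* is (f g)(v) = f (v g^-1).                                                  *)
Definition dual_repr n (rG : mx_representation F G n) :=
  MxRepresentation (dual_mx_repr rG).

Section Induced.

Variables (H : {group gT}) (sHG : H \subset G).
Variables (n : nat) (rH : mx_representation F H n).

Definition coset_repr (i : 'I_#|G : H|) : gT := repr (enum_val i).

(* N (x)_{FH} FG is the direct sum of the N (x) t, for t in a transversal of  *)
(* the right cosets of H in G, and (v (x) t) g = v h (x) t' when t g = h t'   *)
(* with h in H.                                                               *)
Definition ind_mx (g : gT) : 'M[F]_(\sum_(i < #|G : H|) n) :=
  \mxblock_(i < #|G : H|, j < #|G : H|)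
    (let h := (coset_repr i * g * (coset_repr j)^-1)%g in
     if h \in H then rH h else 0).

Lemma coset_reprG i : coset_repr i \in G.
Proof.
rewrite /coset_repr; have /rcosetsP[x Gx ->] := enum_valP i.
by case: repr_rcosetP => h Hh; rewrite groupM // (subsetP sHG).
Qed.

Lemma coset_reprE i : enum_val i = (H :* coset_repr i)%g.
Proof.
by rewrite /coset_repr; have /rcosetsP[x Gx ->] := enum_valP i; rewrite rcoset_repr.
Qed.

Lemma coset_repr_inj i j :
  (coset_repr i * (coset_repr j)^-1)%g \in H -> i = j.
Proof.
rewrite -mem_rcoset => /rcoset_eqP eq_ij.
by apply: enum_val_inj; rewrite !coset_reprE.
Qed.

Lemma coset_repr_ex x : x \in G ->
  exists i, (x * (coset_repr i)^-1)%g \in H.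
Proof.
move=> Gx; have Hx : (H :* x)%g \in rcosets H G by rewrite mem_rcosets mulSGid.
exists (enum_rank_in Hx (H :* x)%g).
by rewrite -mem_rcoset -coset_reprE enum_rankK_in ?rcoset_refl.
Qed.

Lemma ind_mx_repr : mx_repr G ind_mx.
Proof.
split=> [|x y Gx Gy].
  rewrite -mxdiagZ; apply: eq_mxblock => i j; rewrite mulg1 /=.
  case: ifPn => [/coset_repr_inj eq_ij | notHij].
    by rewrite -eq_ij mulgV repr_mx1 eqxx conform_mx_id.
  by case: eqP => // eq_ij; case/negP: notHij; rewrite -eq_ij mulgV group1.
rewrite mul_mxblock; apply: eq_mxblock => i l /=.
have [j Hij] : exists j, (coset_repr i * x * (coset_repr j)^-1)%g \in H.
  by apply: coset_repr_ex; rewrite groupM ?coset_reprG.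
rewrite (bigD1 j) //= Hij big1 ?addr0 => [|j' ne_j'j]; last first.
  case: ifP => [Hij'|_]; last by rewrite mul0mx.
  case/eqP: ne_j'j; apply: coset_repr_inj.
  have -> : (coset_repr j' * (coset_repr j)^-1
    = (coset_repr i * x * (coset_repr j')^-1)^-1
      * (coset_repr i * x * (coset_repr j)^-1))%g.
    by rewrite !invMg invgK !mulgA mulgKV -!mulgA mulKg.
  by rewrite groupM ?groupV.
have -> : (coset_repr i * (x * y) * (coset_repr l)^-1
  = (coset_repr i * x * (coset_repr j)^-1)
    * (coset_repr j * y * (coset_repr l)^-1))%g.
  by rewrite !mulgA mulgKV.
rewrite groupMl //; case: ifP => [Hjl|_]; last by rewrite mulmx0.
by rewrite repr_mxM.
Qed.

Definition ind_repr := MxRepresentation ind_mx_repr.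

End Induced.

Definition mx_indecomposable n (rG : mx_representation F G n) :=
  (0 < n)%N /\
  forall U W : 'M[F]_n, mxmodule rG U -> mxmodule rG W ->
    (U + W :=: 1%:M)%MS -> mxdirect (U + W) -> U = 0 \/ W = 0.

Lemma mem_subgroups (X : {set {group gT}}) (sXG : X \subset subgroups G)
    (i : 'I_#|X|) :
  enum_val i \subset G.
Proof. by have := subsetP sXG _ (enum_valP i); rewrite inE. Qed.

Definition res_ind_sum (X : {set {group gT}}) (sXG : X \subset subgroups G)
    n (rG : mx_representation F G n) : representation F G :=
  \big[dadd_grepr/grepr0]_(i < #|X|)
    Representation (ind_repr (mem_subgroups sXG i)
                             (subg_repr rG (mem_subgroups sXG i))).

Definition rel_projective (X : {set {group gT}}) (sXG : X \subset subgroups G)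
    n (rG : mx_representation F G n) :=
  exists N : representation F G,
    mx_rsim (dadd_grepr (Representation rG) N) (res_ind_sum sXG rG).

Definition subgroups_le m : {set {group gT}} :=
  [set H in subgroups G | (#|H| <= m)%N].

Lemma subgroups_le_sub m : subgroups_le m \subset subgroups G.
Proof. by apply/subsetP=> H; rewrite inE => /andP[]. Qed.

End Constructions.

Arguments subgroups_le {gT} G m.
Arguments subgroups_le_sub {gT} G m.

(* Main.v *)
From HB Require Import structures.
Require Import Defs.
From mathcomp Require Import all_boot all_algebra all_fingroup all_solvable.
From mathcomp Require Import mxrepresentation mxabelem character.
From mathcomp Require Import mpoly.

(** Write W for the dual of S^m(V), q for the order of E, and X for the set of
    subgroups of order at most m.  S(W) is the ring of polynomial functions on
    the space S^m(V) of binary forms of degree m.  The p-group E fixes a linear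
    form e on the plane, and since V is faithful there is a point v0 with
    e(v0) = 1 whose q translates are pairwise non-proportional
    ([unipotent_frame]).  Evaluation of binary forms at these translates gives
    linear forms l_g in W which E permutes regularly ([evW]); by Lagrange
    interpolation any m + 1 of them span W ([interpolation]), and for every
    subset J of E with at most m elements the span of the l_g with g in J has
    a complement C_J in W, the image of [interp_prj J].  The Lagrange
    polynomials have equivariant formulas, so E permutes the C_J as it permutes
    the subsets J ([interp_prjJ]).

    For d >= q, the space S^d(W) is the direct sum, over all subsets J of E
    with at most m elements, of the subspaces

      (product of the l_g with g in E outside J) . S^(d - q + #|J|)(C_J).

    They span ([blocks_span]): modulo the ideal of the l_g with g in J, a
    polynomial agrees with one in S(C_J), and each l_g f that remains is moved
    to the smaller set J minus g.  They are independent ([blocks_indep]):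
    projecting W to C_J for a largest J that occurs in a relation kills all the
    other terms, and the product of the l_g outside J survives.

    The summand of the empty set is a copy of S^(d - q)(W), because the product
    of all the l_g is invariant.  E permutes the other summands, and the
    stabiliser of a nonempty J acts freely on J by translation, so it has at
    most m elements.  The sum of these summands is therefore induced from
    subgroups in X, and projective relative to X; this is organised through
    Higman's criterion, the identity being a sum of relative traces
    ([permuted_projections_trace], [higman_rel_projective]).  Hence S^d(W) is
    S^(d - q)(W) plus a relatively projective module ([sym_repr_step]), and it
    remains to iterate. *)

Set Implicit Arguments.
Unset Strict Implicit.
Unset Printing Implicit Defensive.

Import GroupScope GRing.Theory.
Local Open Scope ring_scope.

(** * Relative traces and relative projectivity *)

Section RelativeProjectivity.

Variables (F : fieldType) (gT : finGroupType) (G : {group gT}).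

Definition intertwines n1 (r1 : mx_representation F G n1) n2
    (r2 : mx_representation F G n2) (A : 'M[F]_(n1, n2)) :=
  forall g, g \in G -> r1 g *m A = A *m r2 g.

Lemma idempotent_factor b (e : 'M[F]_b) : e *m e = e ->
  exists (r : nat) (i : 'M[F]_(r, b)) (p : 'M[F]_(b, r)),
    p *m i = e /\ i *m p = 1%:M.
Proof.
move=> ee; exists (\rank e), (row_base e), (e *m pinvmx (row_base e)).
have pi_e : e *m pinvmx (row_base e) *m row_base e = e.
  by rewrite mulmxKpV // eq_row_base.
split=> //; apply: (row_free_inj (row_base_free e)).
rewrite -mulmxA pi_e mul1mx.
have /submxP[D ->] : (row_base e <= e)%MS by rewrite eq_row_base.
by rewrite -mulmxA ee.
Qed.

(** The complement is realised on the image of the idempotent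
    [1 - prj *m inj]; the maps [i] and [p] are returned so that properties of
    endomorphisms of [rR] can be transported to [N]. *)
Lemma retract_complement a b
    (rM : mx_representation F G a) (rR : mx_representation F G b)
    (inj : 'M[F]_(a, b)) (prj : 'M[F]_(b, a)) :
    intertwines rM rR inj -> intertwines rR rM prj -> inj *m prj = 1%:M ->
  exists (N : representation F G)
    (i : 'M[F]_(rdegree N, b)) (p : 'M[F]_(b, rdegree N)),
  [/\ intertwines N rR i, intertwines rR N p,
      i *m p = 1%:M, p *m i = 1%:M - prj *m inj &
      mx_rsim (dadd_grepr (Representation rM) N) rR].
Proof.
move=> injH prjH injK; set e := 1%:M - prj *m inj.
have eH g : g \in G -> rR g *m e = e *m rR g.
  move=> Gg; rewrite /e mulmxBr mulmxBl mulmx1 mul1mx; congr (_ - _).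
  by rewrite mulmxA prjH // -!mulmxA injH.
have inje : inj *m e = 0 by rewrite mulmxBr mulmx1 mulmxA injK mul1mx subrr.
have eprj : e *m prj = 0 by rewrite mulmxBl mul1mx -mulmxA injK mulmx1 subrr.
have ee : e *m e = e by rewrite {1}/e mulmxBl mul1mx -mulmxA inje mulmx0 subr0.
have [r [i [p [pi ip]]]] := idempotent_factor ee.
have ie : i *m e = i by rewrite -pi mulmxA ip mul1mx.
have ep : e *m p = p by rewrite -pi -mulmxA ip mulmx1.
have NP : mx_repr G (fun g => i *m rR g *m p).
  split=> [|x y Gx Gy]; first by rewrite repr_mx1 mulmx1.
  rewrite repr_mxM // -{1}ie -(mulmxA i e) (mulmxA e (rR x)) -eH // -pi.
  by rewrite !mulmxA.
pose N := MxRepresentation NP.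
have iN : intertwines N rR i.
  by move=> g Gg; rewrite [N g]/(i *m rR g *m p) -mulmxA pi -mulmxA eH //
    mulmxA ie.
have pN : intertwines rR N p.
  by move=> g Gg; rewrite [N g]/(i *m rR g *m p) !mulmxA pi -eH // -mulmxA ep.
exists (Representation N), i, p; split=> //.
have invr : col_mx inj i *m row_mx prj p = 1%:M.
  rewrite mul_col_row injK ip -{1}ep mulmxA inje mul0mx -ie.
  by rewrite -mulmxA eprj mulmx0 -scalar_mx_block.
have invl : row_mx prj p *m col_mx inj i = 1%:M.
  by rewrite mul_row_col pi addrC subrK.
exists (col_mx inj i) => [||g Gg] /=.
- apply/eqP; rewrite eqn_leq.
  have /eqP <- : row_free (col_mx inj i).
    by apply/row_freeP; exists (row_mx prj p).
  rewrite rank_leq_col /= -[X in (X <= _)%N](mxrank1 F) -invl.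
  by rewrite mxrankM_maxr.
- by apply/row_freeP; exists (row_mx prj p).
rewrite mul_block_col !mul0mx addr0 add0r injH //.
by rewrite [i *m _ *m p *m i](iN g Gg) mul_col_mx.
Qed.

Definition rel_trace (H : {group gT}) n (rG : mx_representation F G n)
    (A : 'M[F]_n) : 'M[F]_n :=
  \sum_(i < #|G : H|)
    rG (coset_repr i)^-1%g *m A *m rG (@coset_repr gT G H i).

Definition commutes_on (H : {group gT}) n (rG : mx_representation F G n)
    (A : 'M[F]_n) := forall h, h \in H -> rG h *m A = A *m rG h.

(** One endomorphism is allowed for each subgroup in [X].  In contrast with the
    definition by restriction and induction, this condition visibly passes to
    direct sums and to retracts. *)
Definition higman (X : {set {group gT}}) n (rG : mx_representation F G n) :=
  exists2 theta : {group gT} -> 'M[F]_n,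
    forall H, H \in X -> commutes_on H rG (theta H)
  & \sum_(H in X) rel_trace H rG (theta H) = 1%:M.

Section ToInduced.

Variables (H : {group gT}) (sHG : H \subset G) (n : nat).
Variables (rG : mx_representation F G n) (A : 'M[F]_n).
Hypothesis cA : commutes_on H rG A.

Let rI := ind_repr sHG (subg_repr rG sHG).
Let t_G (i : 'I_#|G : H|) : coset_repr i \in G := coset_reprG sHG i.

(** The two maps are v |-> sum_i (v t_i^-1 A) (x) t_i and v (x) t_i |-> v t_i,
    where the t_i are the coset representatives. *)
Lemma trace_factors_ind : exists (i : 'M[F]_(n, \sum_(j < #|G : H|) n)) p,
  [/\ intertwines rG rI i, intertwines rI rG p & i *m p = rel_trace H rG A].
Proof.
pose t i := @coset_repr gT G H i.
exists (\mxrow_(i < #|G : H|) (rG (t i)^-1%g *m A)).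
exists (\mxcol_(i < #|G : H|) rG (t i)).
split=> [g Gg|g Gg|].
- rewrite mul_mxrow mul_mxrow_mxblock; apply: eq_mxrow => j.
  have [i Hi] : exists i, (t j * g^-1 * (t i)^-1)%g \in H.
    by apply: coset_repr_ex => //; rewrite groupM ?groupV ?t_G.
  have {}Hi : (t i * g * (t j)^-1)%g \in H.
    by rewrite -groupV !invMg !invgK mulgA.
  rewrite (bigD1 i) //= Hi big1 ?addr0 => [|i' ne_i'i]; last first.
    case: ifP => [Hi'|_]; last by rewrite mulmx0.
    case/eqP: ne_i'i; apply: coset_repr_inj => //.
    have -> : (coset_repr i' * (coset_repr i)^-1
      = (t i' * g * (t j)^-1) * (t i * g * (t j)^-1)^-1)%g.
      by rewrite !invMg !invgK !mulgA mulgKV mulgK.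
    by rewrite groupM ?groupV.
  rewrite -[in RHS]mulmxA -cA // [in RHS]mulmxA mulmxA.
  rewrite -!repr_mxM ?groupM ?groupV ?t_G //.
  by rewrite !mulgA mulVg mul1g.
- rewrite mxcol_mul mul_mxblock_mxrow; apply: eq_mxcol => i.
  have [j Hj] : exists j, (t i * g * (t j)^-1)%g \in H.
    by apply: coset_repr_ex => //; rewrite groupM ?t_G.
  rewrite (bigD1 j) //= Hj big1 ?addr0 => [|j' ne_j'j]; last first.
    case: ifP => [Hj'|_]; last by rewrite mul0mx.
    case/eqP: ne_j'j; apply: coset_repr_inj => //.
    have -> : (coset_repr j' * (coset_repr j)^-1
      = (t i * g * (t j')^-1)^-1 * (t i * g * (t j)^-1))%g.
      by rewrite !invMg !invgK !mulgA mulgKV -!mulgA mulKg.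
    by rewrite groupM ?groupV.
  by rewrite -!repr_mxM ?groupM ?groupV ?t_G // mulgKV.
by rewrite mul_mxrow_mxcol.
Qed.

End ToInduced.

Lemma big_dadd_factor (I : Type) (r : seq I) n (rG : mx_representation F G n)
    (R : I -> representation F G) (A : I -> 'M[F]_n) :
    (forall i, exists (u : 'M[F]_(n, rdegree (R i))) v,
      [/\ intertwines rG (R i) u, intertwines (R i) rG v & u *m v = A i]) ->
  exists (u : 'M[F]_(n, rdegree (\big[dadd_grepr/grepr0]_(i <- r) R i))) v,
    [/\ intertwines rG (\big[dadd_grepr/grepr0]_(i <- r) R i) u,
        intertwines (\big[dadd_grepr/grepr0]_(i <- r) R i) rG v
      & u *m v = \sum_(i <- r) A i].
Proof.
move=> facA; elim: r => [|i r [u [v [uH vH uv]]]].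
  rewrite !big_nil; exists 0, 0.
  by split=> [g _|g _|]; rewrite ?mulmx0 ?mul0mx.
rewrite !big_cons; have [ui [vi [uiH viH uvi]]] := facA i.
exists (row_mx ui u), (col_mx vi v); split=> [g Gg|g Gg|] /=.
- by rewrite mul_mx_row mul_row_block !mulmx0 addr0 add0r uiH // uH.
- by rewrite mul_block_col !mul0mx addr0 add0r viH // vH // mul_col_mx.
by rewrite mul_row_col uvi uv.
Qed.

(** The factorisations of the relative traces through the induced modules add
    up to a factorisation of the identity through [res_ind_sum]. *)
Lemma higman_rel_projective (X : {set {group gT}}) (sXG : X \subset subgroups G)
    n (rG : mx_representation F G n) :
  higman X rG -> rel_projective sXG rG.
Proof.
case=> theta c_theta tr1.
have [|u [v [uH vH uv]]] := @big_dadd_factor _ (index_enum 'I_#|X|) n rG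
  (fun i => Representation (ind_repr (mem_subgroups sXG i)
                             (subg_repr rG (mem_subgroups sXG i))))
  (fun i => rel_trace (enum_val i) rG (theta (enum_val i))).
  by move=> i; apply: trace_factors_ind; apply: c_theta; apply: enum_valP.
have [|N [_ [_ [_ _ _ _ simN]]]] := retract_complement uH vH.
  by rewrite uv -tr1 [RHS]big_enum_val.
by exists N.
Qed.

Lemma higman0 (X : {set {group gT}}) : higman X (@grepr0 F gT G).
Proof. by exists (fun _ => 0) => [H _ h _|]; apply/matrixP=> [] []. Qed.

Lemma higman_dadd (X : {set {group gT}}) (r1 r2 : representation F G) :
  higman X r1 -> higman X r2 -> higman X (dadd_grepr r1 r2).
Proof.
case=> t1 c1 tr1 [t2 c2 tr2]; exists (fun H => block_mx (t1 H) 0 0 (t2 H)).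
  move=> H XH h Hh /=; rewrite !mulmx_block !(mulmx0, mul0mx, addr0, add0r).
  by rewrite c1 // c2.
have diagD I (s : seq I) (P : pred I) A1 A2 :
    \sum_(i <- s | P i) block_mx (A1 i) 0 0 (A2 i)
      = block_mx (\sum_(i <- s | P i) A1 i) 0 0 (\sum_(i <- s | P i) A2 i)
    :> 'M[F]_(rdegree r1 + rdegree r2).
  apply: esym; apply: (big_ind3 (fun x y z => block_mx x 0 0 y = z)) => //.
    by rewrite -[0 in RHS](block_mx0 _ _ _ _).
  by move=> x1 y1 z1 x2 y2 z2 <- <-; rewrite add_block_mx !addr0.
rewrite scalar_mx_block -tr1 -tr2 -diagD; apply: eq_bigr => H XH.
rewrite /rel_trace -diagD; apply: eq_bigr => i _ /=.
by rewrite !mulmx_block !(mulmx0, mul0mx, addr0, add0r).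
Qed.

Lemma higman_retract (X : {set {group gT}}) a b
    (rM : mx_representation F G a) (rR : mx_representation F G b)
    (i : 'M[F]_(a, b)) (p : 'M[F]_(b, a)) (theta : {group gT} -> 'M[F]_b) :
    X \subset subgroups G ->
    intertwines rM rR i -> intertwines rR rM p ->
    (forall H, H \in X -> commutes_on H rR (theta H)) ->
    i *m (\sum_(H in X) rel_trace H rR (theta H)) *m p = 1%:M ->
  higman X rM.
Proof.
move=> sXG iH pH c_theta tr1; exists (fun H => i *m theta H *m p).
  move=> H XH h Hh; have Gh : h \in G.
    by have:= subsetP sXG _ XH; rewrite inE => /subsetP; apply.
  rewrite !mulmxA iH // -(mulmxA _ p) -pH // -(mulmxA i (rR h)) c_theta //.
  by rewrite !mulmxA.
rewrite -tr1 mulmx_sumr mulmx_suml; apply: eq_bigr => H XH.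
rewrite /rel_trace mulmx_sumr mulmx_suml; apply: eq_bigr => j _.
have tG : coset_repr j \in G.
  by apply: coset_reprG; have:= subsetP sXG _ XH; rewrite inE.
by rewrite !mulmxA iH ?groupV // -(mulmxA _ p) -pH // !mulmxA.
Qed.

Lemma dadd_rsim0 (r : representation F G) : mx_rsim (dadd_grepr r grepr0) r.
Proof.
exists (col_mx 1%:M 0) => [||g Gg] /=.
- by rewrite addn0.
- apply/row_freeP; exists (row_mx 1%:M 0).
  rewrite mul_col_row !mul0mx mul1mx mulmx0 scalar_mx_block.
  by congr block_mx; apply/matrixP=> [] [].
by rewrite mul_block_col !mul0mx mulmx0 mulmx1 !addr0 mul_col_mx mul1mx mul0mx.
Qed.

Lemma dadd_rsimA (r1 r2 r3 : representation F G) :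
  mx_rsim (dadd_grepr (dadd_grepr r1 r2) r3) (dadd_grepr r1 (dadd_grepr r2 r3)).
Proof.
exists (col_mx (col_mx (row_mx 1%:M 0) (row_mx 0 (row_mx 1%:M 0)))
               (row_mx 0 (row_mx 0 1%:M))) => [||g Gg] /=.
- by rewrite addnA.
- apply/row_freeP; exists (row_mx (row_mx (col_mx 1%:M 0)
     (col_mx 0 (col_mx 1%:M 0))) (col_mx 0 (col_mx 0 1%:M))).
  rewrite mul_col_row !mul_col_row mul_mx_row mul_col_mx.
  rewrite !mul_row_col !(mulmx0, mul0mx, addr0, add0r, mul1mx).
  by rewrite -scalar_mx_block col_mx0 row_mx0 -scalar_mx_block.
rewrite mul_block_col !mul_col_mx !mul_row_block.
rewrite !(mulmx0, mul0mx, addr0, add0r, mul1mx) ?mul_block_col.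
rewrite !mul_mx_row ?mul_row_block.
by rewrite !(mulmx0, mul0mx, addr0, add0r, mul1mx, mulmx1).
Qed.

Lemma dadd_rsim2r (r1 r1' r2 : representation F G) :
  mx_rsim r1 r1' -> mx_rsim (dadd_grepr r1 r2) (dadd_grepr r1' r2).
Proof.
case=> B eq_n freeB BH; exists (block_mx B 0 0 1%:M) => [||g Gg] /=.
- by rewrite eq_n.
- have /row_freeP[B' BB'] := freeB.
  apply/row_freeP; exists (block_mx B' 0 0 1%:M).
  rewrite mulmx_block !(mulmx0, mul0mx, addr0, add0r, mul1mx) BB'.
  by rewrite -scalar_mx_block.
by rewrite !mulmx_block !(mulmx0, mul0mx, addr0, add0r, mul1mx, mulmx1) BH.
Qed.

End RelativeProjectivity.

(** * Permuted families of projections *)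

Section PermutedProjections.

Variables (F : fieldType) (gT : finGroupType) (G : {group gT}).
Variables (n : nat) (rG : mx_representation F G n).
Variables (T : finType) (to : {action gT &-> T}) (D : {set T}).
Variable prj : T -> 'M[F]_n.
Hypothesis actD : forall x g, x \in D -> g \in G -> to x g \in D.
Hypothesis prjJ : forall x g, x \in D -> g \in G ->
  rG g^-1%g *m prj x *m rG g = prj (to x g).

Let stab x : {group gT} := 'C_G[x | to]%G.
(* Choosing in the orbit, and not from x, makes [rep] constant on orbits. *)
Let rep x := odflt x [pick y in orbit to G x].

Lemma rep_orbit x : rep x \in orbit to G x.
Proof.
by rewrite /rep; case: pickP => [y //|/(_ x)]; rewrite orbit_refl.
Qed.

Lemma rep_eq x y : (rep y == rep x) = (y \in orbit to G x).
Proof.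
apply/eqP/idP=> [eq_rep | orb_y].
  have := rep_orbit y; rewrite eq_rep orbit_sym => ory.
  exact: orbit_trans ory (rep_orbit x).
have eqo : orbit to G y = orbit to G x by apply/orbit_eqP.
rewrite /rep eqo; case: pickP => [//|/(_ x)]; by rewrite orbit_refl.
Qed.

(** By [prjJ], the terms of the trace are projections; coset representatives of
    the stabiliser correspond bijectively to points of the orbit. *)
Lemma orbit_sum x : x \in D ->
  rel_trace (stab x) rG (prj x) = \sum_(y in orbit to G x) prj y.
Proof.
move=> Dx; have sHG : stab x \subset G by apply: subsetIl.
pose t (i : 'I_#|G : stab x|) := coset_repr i.
have tG i : t i \in G by apply: coset_reprG.
have -> : orbit to G x = [set to x (t i) | i in 'I_#|G : stab x|].
  apply/setP=> y; apply/orbitP/imsetP=> [[g Gg <-]|[i _ ->]];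
    last by exists (t i).
  have [i /setIP[_ /astab1P]] := coset_repr_ex sHG Gg.
  by move=> fix_i; exists i => //; rewrite -{2}fix_i -actM mulgKV.
rewrite big_imset /=; last first.
  move=> i j _ _ eq_ij; apply: coset_repr_inj => //.
  rewrite inE groupM ?groupV ?tG //=; apply/astab1P.
  by rewrite actM -/(t i) eq_ij -/(t j) actK.
apply: eq_bigr => i _; exact: prjJ.
Qed.

(** A module that is a direct sum of permuted subspaces is the sum, over orbit
    representatives, of modules induced from the stabilisers; in terms of
    endomorphisms, [theta H] collects the projections to the representatives
    whose stabiliser is [H]. *)
Lemma permuted_projections_trace (X : {set {group gT}}) :
    {in D, forall x, stab x \in X} ->
  exists2 theta : {group gT} -> 'M[F]_n,
    forall H, H \in X -> commutes_on H rG (theta H)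
  & \sum_(H in X) rel_trace H rG (theta H) = \sum_(x in D) prj x.
Proof.
move=> stabX.
pose reps H := [pred x in D | (rep x == x) && (stab x == H)].
exists (fun H => \sum_(x | reps H x) prj x) => [H _ h Hh|].
  rewrite mulmx_sumr mulmx_suml; apply: eq_bigr => x /and3P[Dx _ /eqP Hx].
  move: Hh; rewrite -Hx => /setIP[Gh /astab1P fix_h].
  rewrite -{1}fix_h -prjJ // !mulmxA -repr_mxM ?groupV // mulgV.
  by rewrite repr_mx1 mul1mx.
have repD x : x \in D -> rep x \in D.
  by move=> Dx; have /orbitP[g Gg <-] := rep_orbit x; apply: actD.
have rep_id x : rep (rep x) = rep x.
  by apply/eqP; rewrite rep_eq; apply: rep_orbit.
transitivity (\sum_(x in D | rep x == x) rel_trace (stab x) rG (prj x)).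
  rewrite (partition_big stab (mem X)) => [|x /andP[Dx _]]; last exact: stabX.
  apply: eq_bigr => H XH; rewrite /rel_trace /=.
  under [LHS]eq_bigr do rewrite mulmx_sumr mulmx_suml.
  rewrite [LHS]exchange_big; apply: eq_big => [x|x /and3P[_ _ /eqP <-]] //.
  by rewrite /= andbA.
rewrite [RHS](partition_big rep (fun x => (x \in D) && (rep x == x)))
  => [|x Dx].
  apply: eq_bigr => x /andP[Dx /eqP repx]; rewrite orbit_sum //.
  apply: eq_bigl => y; rewrite -{2}repx rep_eq andb_idl //.
  by case/orbitP=> g Gg <-; apply: actD.
by rewrite repD // rep_id eqxx.
Qed.

End PermutedProjections.

Section DirectProjections.

Variables (F : fieldType) (n : nat) (T : finType) (D : {set T}).
Variable M : T -> 'M[F]_n.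
Hypothesis spanM : (1%:M <= \sum_(x in D) M x)%MS.
Hypothesis indepM : forall u : T -> 'rV[F]_n,
  {in D, forall x, u x <= M x}%MS -> \sum_(x in D) u x = 0 ->
  {in D, forall x, u x = 0}.

Lemma direct_projections : exists prj : T -> 'M[F]_n,
  [/\ \sum_(x in D) prj x = 1%:M, {in D, forall x, prj x <= M x}%MS
    & {in D &, forall x y k (v : 'M_(k, n)), (v <= M x)%MS ->
         v *m prj y = if y == x then v else 0}].
Proof.
have /sub_sumsmxP[u def1] := spanM.
have uM x : x \in D -> (u x *m M x <= M x)%MS by rewrite submxMl.
exists (fun x => u x *m M x); split=> // x y Dx Dy k v vM.
apply/row_matrixP=> i; rewrite row_mul.
have {}vM : (row i v <= M x)%MS by rewrite (submx_trans (row_sub _ _)).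
rewrite (fun_if (row i)) row0; apply/eqP; rewrite -subr_eq0; apply/eqP.
pose w z := row i v *m (u z *m M z) - (if z == x then row i v else 0).
have w0 : \sum_(z in D) w z = 0.
  rewrite sumrB -mulmx_sumr -def1 mulmx1 -big_mkcondr /=.
  by rewrite (big_pred1 x) ?subrr // => z; rewrite andb_idl // => /eqP->.
apply: (indepM _ w0) Dy => z Dz; rewrite /w addmx_sub // ?mulmxA ?submxMl //.
by rewrite eqmx_opp; case: eqP => [->|]; rewrite ?sub0mx.
Qed.

End DirectProjections.

(** Projections of a direct sum are determined by the summands, so they are
    permuted as soon as the summands are. *)
Lemma direct_projectionsJ (F : fieldType) (gT : finGroupType) (G : {group gT})
    (n : nat) (rG : mx_representation F G n)
    (T : finType) (to : {action gT &-> T}) (D : {set T}) (M : T -> 'M[F]_n)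
    (prj : T -> 'M[F]_n) :
    (forall x g, x \in D -> g \in G -> to x g \in D) ->
    (forall x g, x \in D -> g \in G -> (M x *m rG g <= M (to x g)%act)%MS) ->
    \sum_(x in D) prj x = 1%:M -> {in D, forall x, prj x <= M x}%MS ->
    {in D &, forall x y k (v : 'M_(k, n)), (v <= M x)%MS ->
         v *m prj y = if y == x then v else 0} ->
  forall x g, x \in D -> g \in G ->
  rG g^-1%g *m prj x *m rG g = prj (to x g).
Proof.
move=> actD MJ sum1 prjM prjK x g Dx Gg; set A := _ *m rG g.
have Dxg := actD x g Dx Gg.
have yA y : y \in D -> prj y *m A = if y == to x g then prj y else 0.
  move=> Dy; have Gg' : g^-1%g \in G by rewrite groupV.
  have yM : (prj y *m rG g^-1%g <= M (to y g^-1%g))%MS.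
    by rewrite (submx_trans _ (MJ _ _ Dy Gg')) // submxMr ?prjM.
  rewrite /A !mulmxA (prjK _ _ (actD _ _ Dy Gg') Dx _ _ yM).
  rewrite eq_sym (can2_eq (actK to g^-1%g) (actKV to g^-1%g)) invgK.
  case: eqP => // _; last by rewrite mul0mx.
  by rewrite -mulmxA -repr_mxM // mulVg repr_mx1 mulmx1.
rewrite -[A]mul1mx -sum1 mulmx_suml (eq_bigr _ yA) -big_mkcondr /=.
by rewrite (big_pred1 (to x g)) // => z; rewrite andb_idl // => /eqP->.
Qed.

(** * Homogeneous polynomials and linear substitutions *)

Section LinearForms.

Variables (F : fieldType) (n : nat).
Implicit Types (u v : 'rV[F]_n) (A B : 'M[F]_n) (p : {mpoly F[n]}).

Definition lform v : {mpoly F[n]} := \sum_(j < n) v 0 j *: 'X_j.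
Definition subst A p := p \mPo linear_forms A.

Lemma substM A : {morph subst A : p q / p * q}.
Proof. by move=> p q; rewrite /subst rmorphM. Qed.

Lemma subst_prod A (I : Type) (r : seq I) (P : pred I) f :
  subst A (\prod_(i <- r | P i) f i) = \prod_(i <- r | P i) subst A (f i).
Proof. by rewrite /subst rmorph_prod. Qed.

Lemma subst_sum A (I : Type) (r : seq I) (P : pred I) f :
  subst A (\sum_(i <- r | P i) f i) = \sum_(i <- r | P i) subst A (f i).
Proof. by rewrite /subst raddf_sum. Qed.

Lemma substZ A c p : subst A (c *: p) = c *: subst A p.
Proof. exact: comp_mpolyZ. Qed.

Lemma subst1 p : subst 1%:M p = p.
Proof. by rewrite /subst linear_forms1 comp_mpoly_id. Qed.

Lemma subst_mulmx A B p : subst (A *m B) p = subst B (subst A p).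
Proof. exact: linear_formsM. Qed.

Lemma substX A i : subst A 'X_i = lform (row i A).
Proof.
rewrite /subst comp_mpolyXU -tnth_nth tnth_mktuple.
by apply: eq_bigr => j _; rewrite mxE.
Qed.

Lemma lform_is_linear : linear lform.
Proof.
move=> c u v; rewrite /lform scaler_sumr -big_split; apply: eq_bigr => j _.
by rewrite !mxE scalerA scalerDl.
Qed.
HB.instance Definition _ := GRing.isLinear.Build F 'rV[F]_n {mpoly F[n]} _ lform
  lform_is_linear.

Lemma lform_eq0 v : (lform v == 0) = (v == 0).
Proof.
apply/eqP/eqP=> [v0|->]; last exact: raddf0.
apply/rowP=> i; rewrite mxE; have /(congr1 (mcoeff U_(i))) := v0.
rewrite mcoeff0 raddf_sum /= (bigD1 i) //= big1 => [|j ne_ji].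
  by rewrite mcoeffZ mcoeffXU eqxx mulr1 addr0.
by rewrite mcoeffZ mcoeffXU (negPf ne_ji) mulr0.
Qed.

Lemma subst_lform A v : subst A (lform v) = lform (v *m A).
Proof.
rewrite subst_sum mulmx_sum_row raddf_sum; apply: eq_bigr => i _.
by rewrite substZ substX /= linearZ.
Qed.

Lemma lform_homog v : lform v \is 1.-homog.
Proof. by rewrite rpred_sum // => j _; rewrite rpredZ // dhomogX /= mdeg1. Qed.

Lemma homog_mon d p : p \is d.-homog ->
  p = \sum_(i < #|sym_basis n d|) p@_(sym_mon i) *: 'X_[sym_mon i].
Proof.
move=> hp; have sz : (msize p <= d.+1)%N.
  rewrite msizeE; apply/bigmax_leqP_seq => m pm _.
  by rewrite (dhomogP _ _ _ hp m pm).
rewrite -{1}(pihomog_dE hp) (pihomogwE _ _ sz).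
rewrite (eq_bigl (fun m => m \in sym_basis n d)) => [|m]; last by rewrite !inE.
by rewrite big_enum_val.
Qed.

Lemma sym_mon_homog d i : 'X_[@sym_mon n d i] \is [in F[n], d.-homog].
Proof. by rewrite dhomogX /= mdeg_sym_mon. Qed.

Lemma subst_homog A d p : p \is d.-homog -> subst A p \is d.-homog.
Proof.
move=> hp; rewrite (homog_mon hp) subst_sum rpred_sum // => i _.
rewrite substZ rpredZ // -{2}(mdeg_sym_mon i); exact: homog_linear_forms.
Qed.

Lemma split_mon e (k : 'X_{1..n}) : mdeg k = e.+1 ->
  exists i k', mdeg k' = e /\ 'X_[k] = 'X_i * 'X_[k'] :> {mpoly F[n]}.
Proof.
move=> dk; have /existsP[i ki] : [exists i, k i != 0%N].
  apply: contraPT (eqxx (mdeg k)) => /existsPn k0; rewrite {1}dk mdegE.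
  by rewrite big1 // => i _; apply/eqP; have := k0 i; rewrite negbK.
have leik : (U_(i) <= k)%MM by rewrite lep1mP.
exists i, (k - U_(i))%MM; split; last by rewrite -mpolyXD addmC submK.
by apply/eqP; rewrite -(eqn_add2r 1) -{1}(mdeg1 i) -mdegD submK // addn1 dk.
Qed.

Lemma subst0 e p : p \is e.+1.-homog -> subst 0 p = 0.
Proof.
move/homog_mon->; rewrite subst_sum big1 // => i _; rewrite substZ.
have [j [k [_ ->]]] := split_mon (mdeg_sym_mon i).
by rewrite substM substX row0 raddf0 mul0r scaler0.
Qed.

Section Coordinates.

Variable d : nat.
Implicit Type w : 'rV[F]_#|sym_basis n d|.

Definition coords p : 'rV[F]_#|sym_basis n d| := \row_i p@_(sym_mon i).
Definition poly_of w := \sum_i w 0 i *: 'X_[sym_mon i] : {mpoly F[n]}.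

Lemma poly_of_is_linear : linear poly_of.
Proof.
move=> c u v; rewrite /poly_of scaler_sumr -big_split; apply: eq_bigr => j _.
by rewrite !mxE scalerA scalerDl.
Qed.
HB.instance Definition _ := GRing.isLinear.Build F 'rV[F]_#|sym_basis n d| 
  {mpoly F[n]} _ poly_of poly_of_is_linear.

Lemma coords_is_linear : linear coords.
Proof. by move=> c p q; apply/rowP=> i; rewrite !mxE linearP. Qed.
HB.instance Definition _ := GRing.isLinear.Build F {mpoly F[n]} 
  'rV[F]_#|sym_basis n d| _ coords coords_is_linear.

Lemma poly_of_homog w : poly_of w \is d.-homog.
Proof. by rewrite rpred_sum // => i _; rewrite rpredZ // sym_mon_homog. Qed.

Lemma coordsK p : p \is d.-homog -> poly_of (coords p) = p.
Proof.
by move=> hp; rewrite [RHS](homog_mon hp); apply: eq_bigr => i _; rewrite mxE.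
Qed.

Lemma poly_ofK : cancel poly_of coords.
Proof.
move=> w; apply/rowP=> i; rewrite mxE raddf_sum (bigD1 i) //= big1
  => [|j ne_ji].
  by rewrite mcoeffZ mcoeffX eqxx mulr1 addr0.
rewrite mcoeffZ mcoeffX -bmeqP (inj_eq enum_val_inj).
by rewrite (negPf ne_ji) mulr0.
Qed.

Lemma poly_of_inj : injective poly_of. Proof. exact: can_inj poly_ofK. Qed.

(** Through [poly_of], the matrix action on the symmetric power becomes
    substitution, so everything below can be computed with polynomials. *)
Lemma poly_of_sym_mx A w : poly_of (w *m sym_mx d A) = subst A (poly_of w).
Proof.
rewrite subst_sum mulmx_sum_row raddf_sum; apply: eq_bigr => i _.
rewrite /= linearZ substZ; congr (_ *: _).
rewrite -[RHS]coordsK; last exact/subst_homog/sym_mon_homog.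
by congr poly_of; apply/rowP=> j; rewrite !mxE.
Qed.

End Coordinates.

End LinearForms.

(** * The decomposition attached to an arrangement of linear forms *)

Section Arrangement.

Variables (F : fieldType) (n m : nat) (T : finType) (E : {set T}).
Variables (l : T -> 'rV[F]_n) (prj : {set T} -> 'M[F]_n).

(* For #|J| <= m, [prj J] is a projection whose kernel is the span of the l x
   with x in J, and no other l x lies in that kernel.  For larger J the l x
   with x in J span the whole space, and [prj J] is zero. *)
Hypothesis prj_span : forall J : {set T}, J \subset E ->
  exists a : T -> 'cV[F]_n, 1%:M - prj J = \sum_(x in J) a x *m l x.
Hypothesis prj_kill : forall (J : {set T}) x,
  J \subset E -> x \in J -> l x *m prj J = 0.
Hypothesis prj_live : forall (J : {set T}) x, J \subset E -> (#|J| <= m)%N ->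
  x \in E -> x \notin J -> l x *m prj J != 0.
Hypothesis prj_big : forall J : {set T},
  J \subset E -> (m < #|J|)%N -> prj J = 0.

Lemma prj_idem (J : {set T}) : J \subset E -> prj J *m prj J = prj J.
Proof.
move=> sJE; have [a defa] := prj_span sJE; apply/eqP.
rewrite -subr_eq0 -oppr_eq0 opprB -{1}[prj J]mul1mx -mulmxBl defa.
rewrite mulmx_suml big1 // => x Jx.
by rewrite -mulmxA prj_kill // mulmx0.
Qed.

Lemma prj_set0 : prj set0 = 1%:M.
Proof.
have [a] := prj_span (sub0set E); rewrite big_set0 => /eqP.
by rewrite subr_eq0 => /eqP.
Qed.

(** Substituting [prj J] changes a polynomial only by an element of the ideal
    of the l x with x in J, and homogeneously so.  The product rule reduces
    this to the variables, where it is [prj_span]. *)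
Lemma homog_subst_diff (J : {set T}) : J \subset E ->
    forall e (p : {mpoly F[n]}),
  p \is e.+1.-homog ->
  exists2 h : T -> {mpoly F[n]}, forall x, h x \is e.-homog
  & p - subst (prj J) p = \sum_(x in J) lform (l x) * h x.
Proof.
move=> sJE; have [a defa] := prj_span sJE.
pose good e p := exists2 h : T -> {mpoly F[n]}, forall x, h x \is e.-homog
  & p - subst (prj J) p = \sum_(x in J) lform (l x) * h x.
have goodD e p q : good e p -> good e q -> good e (p + q).
  case=> h hh hE [h' hh' hE']; exists (fun x => h x + h' x).
    by move=> x; rewrite rpredD.
  rewrite /subst raddfD /= opprD addrACA [_ - _]hE [_ - _]hE' -big_split.
  by apply: eq_bigr => x _; rewrite mulrDr.
have goodZ e c p : good e p -> good e (c *: p).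
  case=> h hh hE; exists (fun x => c *: h x).
    by move=> x; rewrite rpredZ.
  rewrite substZ -scalerBr hE scaler_sumr.
  by apply: eq_bigr => x _; rewrite scalerAr.
have good0 e : good e 0.
  exists (fun _ => 0) => [x|]; first exact: rpred0.
  by rewrite /subst raddf0 subr0 big1 // => x _; rewrite mulr0.
have good_homog e : (forall k : 'X_{1..n}, mdeg k = e.+1 -> good e 'X_[k]) ->
    forall p, p \is e.+1.-homog -> good e p.
  move=> goodX p /homog_mon ->; elim/big_ind: _ => // [p1 p2|i _].
    exact: goodD.
  by apply/goodZ/goodX; apply: mdeg_sym_mon.
have good_step e i (k : 'X_{1..n}) (h' : T -> {mpoly F[n]}) : mdeg k = e ->
    (forall x, h' x \is e.-homog) ->
    lform (row i (prj J)) * ('X_[k] - subst (prj J) 'X_[k])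
      = \sum_(x in J) lform (l x) * h' x -> good e ('X_i * 'X_[k]).
  move=> dk hh' defh'; exists (fun x => a x i 0 *: 'X_[k] + h' x) => [x|].
    by rewrite rpredD // rpredZ // dhomogX /= dk.
  rewrite substM substX.
  transitivity (lform (row i (1%:M - prj J)) * 'X_[k]
      + lform (row i (prj J)) * ('X_[k] - subst (prj J) 'X_[k])).
    rewrite linearB raddfB /= -(substX 1%:M) subst1 mulrBl mulrBr addrA.
    by rewrite subrK.
  rewrite defh' defa !raddf_sum mulr_suml -big_split; apply: eq_bigr => x _ /=.
  rewrite mulrDr; congr (_ + _); rewrite -scalerAr scalerAl; congr (_ * _).
  rewrite -linearZ; congr lform; apply/rowP=> j.
  by rewrite !mxE big_ord1.
elim=> [|e IHe]; apply: good_homog => k /(@split_mon F n)[i [k' [dk' ->]]].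
  apply: (good_step _ i k' (fun _ => 0) dk') => [x|]; first exact: rpred0.
  move/eqP: dk'; rewrite mdeg_eq0 => /eqP ->; rewrite mpolyX0.
  rewrite /subst comp_mpoly1 subrr mulr0 big1 // => x _; exact: mulr0.
have [|h hh defh] := IHe 'X_[k']; first by rewrite dhomogX /= dk'.
apply: (good_step _ i k' (fun x => lform (row i (prj J)) * h x) dk') => [x|].
  exact: dhomogM (lform_homog _) (hh x).
by rewrite defh mulr_sumr; apply: eq_bigr => x _; rewrite mulrCA.
Qed.

Definition form_prod (I : {set T}) : {mpoly F[n]} := \prod_(x in I) lform (l x).

Lemma prod_lform_homog (I : {set T}) : form_prod I \is #|I|.-homog.
Proof.
rewrite /form_prod -sum1_card; elim/big_rec2: _ => [|x d p _ hp].
  exact: dhomog1.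
exact: dhomogM (lform_homog _) hp.
Qed.

Section Degree.

Variable d : nat.

(** The row space is the summand of J.  Substituting [prj J] in monomials gives a
    spanning family of S(C_J), for C_J the image of [prj J], that requires no
    basis of C_J. *)
Definition block (J : {set T}) : 'M[F]_#|sym_basis n d| :=
  genmx (\matrix_i coords d (form_prod (E :\: J) *
       subst (prj J) 'X_[@sym_mon n (d - #|E :\: J|) i])).

Hypothesis le_Ed : (#|E| <= d)%N.

Lemma le_ED J : (#|E :\: J| <= d)%N.
Proof. by rewrite (leq_trans _ le_Ed) // subset_leq_card // subsetDl. Qed.

Lemma block_term_homog J p : p \is (d - #|E :\: J|).-homog ->
  form_prod (E :\: J) * subst (prj J) p \is d.-homog.
Proof.
move=> hp; rewrite -(subnKC (le_ED J)); apply: dhomogM.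
  exact: prod_lform_homog.
exact: subst_homog.
Qed.

Lemma blockP (J : {set T}) (w : 'rV[F]_#|sym_basis n d|) :
  reflect (exists2 p : {mpoly F[n]}, p \is (d - #|E :\: J|).-homog
           & poly_of w = form_prod (E :\: J) * subst (prj J) p)
          (w <= block J)%MS.
Proof.
rewrite genmxE; set e := (d - _)%N; set M := matrix_of_fun _ _.
have combM (u : 'rV_#|sym_basis n e|) :
    poly_of (u *m M) = form_prod (E :\: J) * subst (prj J) (poly_of u).
  rewrite mulmx_sum_row raddf_sum subst_sum mulr_sumr; apply: eq_bigr => i _ /=.
  rewrite linearZ /= rowK coordsK ?block_term_homog ?sym_mon_homog //.
  by rewrite substZ scalerAr.
apply: (iffP submxP) => [[u ->]|[p hp defw]].
  by exists (poly_of u); rewrite ?poly_of_homog ?combM.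
exists (coords e p); apply: poly_of_inj.
by rewrite combM coordsK.
Qed.

Let D := [set J in powerset E | (#|J| <= m)%N].

(** Let J be of maximal size among the sets with a nonzero term.  Any other set
    J' in the relation misses some x in J, so the term of J' is divisible by
    l x and is killed by [prj J]; the term of J must then vanish as well, since
    [prj J] kills no factor of [form_prod (E :\: J)]. *)
Lemma blocks_indep (u : {set T} -> 'rV[F]_#|sym_basis n d|) :
  {in D, forall J, u J <= block J}%MS -> \sum_(J in D) u J = 0 ->
  {in D, forall J, u J = 0}.
Proof.
move=> uM sum0 J1 DJ1; apply/eqP; apply: contraT => u1_neq0.
have [J /andP[DJ uJ_neq0] maxJ] : exists2 J, (J \in D) && (u J != 0) &
    forall J', J' \in D -> u J' != 0 -> (#|J'| <= #|J|)%N.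
  case: (arg_maxnP (P := fun J => (J \in D) && (u J != 0))
           (fun J => #|J|) (i0 := J1)) => [|J DJ maxJ]; first exact/andP.
  by exists J => // J' DJ' uJ'; apply: maxJ; apply/andP.
have [sJE leJm] : J \subset E /\ (#|J| <= m)%N.
  by move: DJ; rewrite !inE => /andP.
have [p hp defu] := blockP _ _ (uM J DJ).
have other J' : J' \in D -> J' != J -> subst (prj J) (poly_of (u J')) = 0.
  move=> DJ' neJ'J; have [->|uJ'] := eqVneq (u J') 0.
    by rewrite raddf0 /subst raddf0.
  have [p' _ ->] := blockP _ _ (uM J' DJ').
  have [x Jx J'x] : exists2 x, x \in J & x \notin J'.
    apply/subsetPn; apply: contra neJ'J => sJJ'.
    by rewrite eq_sym eqEcard sJJ' maxJ.
  rewrite substM subst_prod (bigD1 x) /= ?inE ?J'x ?(subsetP sJE) //.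
  by rewrite subst_lform prj_kill // raddf0 !mul0r.
have := congr1 (fun w => subst (prj J) (poly_of w)) sum0.
rewrite raddf_sum subst_sum (bigD1 J) //= big1
  => [|J' /andP[]]; last exact: other.
rewrite addr0 raddf0 [subst _ 0]raddf0 defu substM -subst_mulmx prj_idem //.
move/eqP; rewrite mulf_eq0 => /orP[|/eqP p0]; last first.
  by case/eqP: uJ_neq0; apply: poly_of_inj; rewrite defu p0 mulr0 raddf0.
rewrite subst_prod prodf_seq_eq0 => /hasP[x _ /andP[]].
rewrite inE => /andP[J'x Ex]; rewrite subst_lform lform_eq0.
by rewrite (negPf (prj_live _ _ _ _)).
Qed.

(** Induction on the size of J.  The case J = E is what is wanted; the
    generalisation to multiples of [form_prod (E :\: J)] is what the induction
    passes through. *)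
Lemma arrangement_span (J : {set T}) p : J \subset E ->
  p \is (d - #|E :\: J|).-homog ->
  (coords d (form_prod (E :\: J) * p) <= \sum_(K in D) block K)%MS.
Proof.
have [k] := ubnP #|J|; elim: k => // k IHk in J p * => /ltnSE leJk sJE hp.
have inblock q : (#|J| <= m)%N -> q \is (d - #|E :\: J|).-homog ->
    (coords d (form_prod (E :\: J) * subst (prj J) q)
       <= \sum_(K in D) block K)%MS.
  move=> leJm hq; rewrite (sumsmx_sup J) ?inE ?sJE //.
  by apply/blockP; exists q; rewrite // coordsK ?block_term_homog.
(* A positive size of J gives the positive degree that is needed to split p. *)
have [J0 | J_gt0] := posnP #|J|.
  rewrite -[p]subst1 -prj_set0 -(cards0_eq J0).
  by apply: inblock; rewrite ?J0.
have szD : (d - #|E :\: J| = (d - #|E :\: J|).-1.+1)%N.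
  rewrite prednK // subn_gt0 (leq_trans _ le_Ed) // cardsDS //.
  by rewrite ltn_subrL J_gt0 (leq_trans J_gt0) // subset_leq_card.
move: (hp); rewrite szD => hp1.
have [h hh defp] := homog_subst_diff sJE hp1.
rewrite -[p](subrK (subst (prj J) p)) mulrDr linearD /=.
rewrite addmx_sub // ?defp.
  rewrite mulr_sumr linear_sum summx_sub // => x Jx /=.
  have defDx : E :\: (J :\ x) = x |: (E :\: J).
    by rewrite setDDr setIC (setIidPl _) ?sub1set ?(subsetP sJE) // setUC.
  have x'D : x \notin E :\: J by rewrite inE Jx.
  rewrite mulrA [form_prod _ * _]mulrC -[_ * form_prod _](big_setU1 _ x'D).
  rewrite -defDx.
  apply: IHk; first by rewrite (leq_trans _ leJk) // [#|J|](cardsD1 x) Jx.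
    by rewrite (subset_trans _ sJE) // subsetDl.
  by rewrite defDx cardsU1 x'D add1n subnS.
have [|gtJm] := leqP #|J| m; first by move/inblock; apply.
by rewrite prj_big // (subst0 hp1) mulr0 linear0 sub0mx.
Qed.

Lemma blocks_span : (1%:M <= \sum_(J in D) block J)%MS.
Proof.
apply/row_subP=> i; rewrite -(poly_ofK (row i _)).
have := arrangement_span (subxx E) (p := poly_of (row i 1%:M)).
rewrite setDv cards0 subn0 poly_of_homog /form_prod big_set0 mul1r.
exact.
Qed.

End Degree.

End Arrangement.

(** * Reducing the degree by the order of the group *)

Lemma big_rcoset (R : Type) (idx : R) (op : Monoid.com_law idx)
    (gT : finGroupType) (J : {set gT}) g (f : gT -> R) :
  \big[op/idx]_(y in J :* g) f y = \big[op/idx]_(y in J) f (y * g)%g.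
Proof.
by rewrite -rcosetE /rcoset big_imset //= => x y _ _; apply: mulIg.
Qed.

Section SymmetricPowerStep.

Variables (F : fieldType) (n m : nat) (gT : finGroupType) (G : {group gT}).
Variable W : mx_representation F G n.
Variables (l : gT -> 'rV[F]_n) (prj : {set gT} -> 'M[F]_n).

Hypothesis prj_span : forall J : {set gT}, J \subset G ->
  exists a : gT -> 'cV[F]_n, 1%:M - prj J = \sum_(x in J) a x *m l x.
Hypothesis prj_kill : forall (J : {set gT}) x,
  J \subset G -> x \in J -> l x *m prj J = 0.
Hypothesis prj_live : forall (J : {set gT}) x,
  J \subset G -> (#|J| <= m)%N -> x \in G -> x \notin J -> l x *m prj J != 0.
Hypothesis prj_big : forall J : {set gT},
  J \subset G -> (m < #|J|)%N -> prj J = 0.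
Hypothesis lJ : forall x g, x \in G -> g \in G -> l x *m W g = l (x * g)%g.
Hypothesis prjJ : forall (J : {set gT}) g, J \subset G -> g \in G ->
  prj J *m W g = W g *m prj (J :* g).

Lemma subst_form_prod (I : {set gT}) g : I \subset G -> g \in G ->
  subst (W g) (form_prod l I) = form_prod l (I :* g).
Proof.
move=> sIG Gg; rewrite /form_prod big_rcoset subst_prod; apply: eq_bigr => x Ix.
by rewrite subst_lform lJ // (subsetP sIG).
Qed.

Lemma setD_rcoset (J : {set gT}) g : g \in G -> G :\: J :* g = (G :\: J) :* g.
Proof.
move=> Gg; apply/setP=> x.
by rewrite !(inE, mem_rcoset) groupMr ?groupV.
Qed.

Lemma block_rcoset d (J : {set gT}) g : (#|G| <= d)%N ->
  J \subset G -> g \in G ->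
  (block G l prj d J *m sym_repr W d g <= block G l prj d (J :* g))%MS.
Proof.
move=> le_Gd sJG Gg; apply/row_subP=> i; rewrite row_mul.
have /(blockP _ _ le_Gd)[p hp defw] := row_sub i (block G l prj d J).
apply/blockP=> //; exists (subst (W g) p).
  by rewrite setD_rcoset // card_rcoset subst_homog.
rewrite poly_of_sym_mx defw substM subst_form_prod ?subsetDl // setD_rcoset //.
by rewrite -!subst_mulmx prjJ.
Qed.

(** The stabiliser H acts freely on J by translation: for x in J, the left coset
    x H is contained in J. *)
Lemma stab_rcoset_le (J : {set gT}) : J \subset G -> (#|J| <= m)%N ->
  J != set0 -> 'C_G[J | 'Rs]%G \in subgroups_le G m.
Proof.
move=> sJG leJm /set0Pn[x Jx]; rewrite !inE subsetIl /=.
apply: leq_trans leJm; rewrite -[X in (X <= _)%N](card_lcoset _ x).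
apply/subset_leq_card.
apply/subsetP=> y; rewrite mem_lcoset => /setIP[_ /astab1P fix_h].
by rewrite -fix_h /= rcosetE mem_rcoset invMg invgK mulKVg.
Qed.

(** [blocks_span] and [blocks_indep] decompose S^d.  Multiplication by the
    invariant [form_prod l G] identifies S^(d - #|G|) with the summand of the
    empty set; the sum of the others satisfies Higman's criterion. *)
Lemma sym_repr_step d : (#|G| <= d)%N ->
  exists2 Q : representation F G, higman (subgroups_le G m) Q
  & mx_rsim (dadd_grepr (Representation (sym_repr W (d - #|G|))) Q)
            (sym_repr W d).
Proof.
move=> le_Gd.
pose D := [set J in powerset G | (#|J| <= m)%N].
have actD J g : J \in D -> g \in G -> 'Rs%act J g \in D.
  rewrite !inE /= => /andP[sJG leJm] Gg; rewrite rcosetE card_rcoset leJm.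
  by rewrite mul_subG ?sub1set.
have [P [sumP PM PK]] := direct_projections (blocks_span prj_span prj_big le_Gd)
  (blocks_indep prj_span prj_kill prj_live le_Gd).
have PJ : forall J g, J \in D -> g \in G ->
    sym_repr W d g^-1%g *m P J *m sym_repr W d g = P ('Rs%act J g).
  apply: direct_projectionsJ PM PK => // J g.
  by rewrite inE powersetE => /andP[sJG _] Gg; rewrite /= rcosetE block_rcoset.
have D0 : set0 \in D by rewrite !inE sub0set cards0.
have [||J|theta c_theta tr_theta] := @permuted_projections_trace _ _ _ _
    (sym_repr W d) _ 'Rs%act (D :\ set0) P _ _ (subgroups_le G m).
- move=> J g /setD1P[nJ DJ] Gg; rewrite in_setD1 actD // andbT.
  by rewrite -card_gt0 /= rcosetE card_rcoset card_gt0.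
- by move=> J g /setD1P[_ DJ]; apply: PJ.
- case/setD1P=> nJ; rewrite [_ \in D]inE powersetE => /andP[sJG leJm].
  exact: stab_rcoset_le.
have {}tr_theta : \sum_(H in subgroups_le G m)
    rel_trace H (sym_repr W d) (theta H) = 1%:M - P set0.
  rewrite tr_theta -sumP (big_setD1 _ D0) /= addrC addrK //.
(* The image of [inj] is the summand of the empty set, so that dividing the
   projection to this summand by [inj] gives an equivariant retraction. *)
pose inj : 'M_(_, #|sym_basis n d|) :=
  \matrix_i coords d (form_prod l G * 'X_[@sym_mon n (d - #|G|) i]).
have N_homog p : p \is (d - #|G|).-homog -> form_prod l G * p \is d.-homog.
  by move=> hp; rewrite -(subnKC le_Gd); apply/dhomogM/hp/prod_lform_homog.
have poly_inj u : poly_of (u *m inj) = form_prod l G * poly_of u.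
  rewrite mulmx_sum_row raddf_sum mulr_sumr; apply: eq_bigr => i _ /=.
  by rewrite linearZ /= rowK coordsK ?N_homog ?sym_mon_homog ?scalerAr.
have N_neq0 : form_prod l G != 0.
  apply/prodf_neq0 => x Gx; rewrite lform_eq0.
  have := prj_live (sub0set G) _ Gx; rewrite cards0 inE => /(_ isT isT).
  by apply: contraNneq => ->; rewrite mul0mx.
have inj_free : row_free inj.
  apply: inj_row_free => u /(congr1 (@poly_of _ _ _)).
  rewrite poly_inj raddf0 => /eqP; rewrite mulf_eq0 (negPf N_neq0) /=.
  by move=> /eqP u0; apply: poly_of_inj; rewrite u0 raddf0.
have prj0 : prj set0 = 1%:M by apply: prj_set0 prj_span.
have injB : (inj <= block G l prj d set0)%MS.
  apply/row_subP=> i; apply/blockP=> //; exists 'X_[sym_mon i].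
    by rewrite setD0 sym_mon_homog.
  by rewrite rowK coordsK ?N_homog ?sym_mon_homog // setD0 prj0 subst1.
have Binj : (block G l prj d set0 <= inj)%MS.
  apply/row_subP=> i.
  have /(blockP _ _ le_Gd)[p] := row_sub i (block G l prj d set0).
  rewrite setD0 prj0 subst1 => hp defw; apply/submxP; exists (coords _ p).
  by apply: poly_of_inj; rewrite poly_inj coordsK.
have injH : intertwines (sym_repr W (d - #|G|)) (sym_repr W d) inj.
  move=> g Gg; apply/row_matrixP=> i; apply: poly_of_inj.
  rewrite !rowE !mulmxA poly_inj !poly_of_sym_mx poly_inj.
  by rewrite substM subst_form_prod // rcoset_id.
have P0inj := submx_trans (PM _ D0) Binj.
have [ret retK] : exists ret, ret *m inj = P set0.
  by exists (P set0 *m pinvmx inj); rewrite mulmxKpV.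
have injK : inj *m ret = 1%:M.
  apply: (row_free_inj inj_free); rewrite -mulmxA retK mul1mx.
  by rewrite (PK _ _ D0 D0 _ _ injB) eqxx.
have retH : intertwines (sym_repr W d) (sym_repr W (d - #|G|)) ret.
  move=> g Gg; apply: (row_free_inj inj_free); rewrite -!mulmxA injH //.
  rewrite retK [RHS]mulmxA retK.
  have fix0 : sym_repr W d g^-1%g *m P set0 *m sym_repr W d g = P set0.
    by rewrite (PJ _ g D0 Gg); congr P; apply: imset0.
  by rewrite -{1}fix0 !mulmxA -repr_mxM ?groupV // mulgV repr_mx1 mul1mx.
have [N [i [p [iH pH ip pi simN]]]] := retract_complement injH retH injK.
exists N => //; apply: (higman_retract (subgroups_le_sub G m) iH pH c_theta).
by rewrite tr_theta -retK -pi !mulmxA ip mul1mx.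
Qed.

End SymmetricPowerStep.

(** * Evaluation of binary forms and Lagrange interpolation *)

Lemma setD1_rcoset (gT : finGroupType) (J : {set gT}) x g :
  (J :* g) :\ (x * g)%g = (J :\ x) :* g.
Proof.
apply/setP=> y; rewrite !(inE, mem_rcoset); congr (~~ _ && _).
by apply/eqP/eqP=> [-> | <-]; rewrite ?mulgK ?mulgKV.
Qed.

Lemma card_sym_basis2 m : (#|sym_basis 2 m| <= m.+1)%N.
Proof.
pose f (k : 'X_{1..2 < m.+1}) : 'I_m.+1 := inord (k ord0).
rewrite -[X in (_ <= X)%N]card_ord -(@card_in_imset _ _ f) ?max_card //.
move=> k1 k2; rewrite !inE !mdegE !big_ord_recl !big_ord0 !addn0.
move=> /eqP d1 /eqP d2 /(congr1 val).
have le1 : (k1 ord0 <= m)%N by rewrite -[leqRHS]d1 leq_addr.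
have le2 : (k2 ord0 <= m)%N by rewrite -[leqRHS]d2 leq_addr.
rewrite /f /= !inordK // => eq0.
apply: val_inj; apply/mnmP=> i.
have eq1 : k1 (lift ord0 ord0) = k2 (lift ord0 ord0).
  by apply/eqP; rewrite -(eqn_add2l (k1 ord0)) d1 eq0 d2.
by case: (unliftP ord0 i) => [j ->|-> //]; rewrite (ord1 j).
Qed.

Section Evaluation.

Variables (F : fieldType) (n : nat).

Definition eval (v : 'cV[F]_n) (p : {mpoly F[n]}) := p.@[fun i => v i 0].

Lemma eval_subst v A p : eval v (subst A p) = eval (A *m v) p.
Proof.
rewrite /eval /subst comp_mpoly_meval; apply: meval_eq => i.
rewrite tnth_mktuple raddf_sum !mxE; apply: eq_bigr => j _ /=.
by rewrite mevalZ mevalXU.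
Qed.

Lemma eval_lform v u : eval v (lform u) = (u *m v) 0 0.
Proof.
rewrite /eval /lform raddf_sum !mxE; apply: eq_bigr => j _ /=.
by rewrite mevalZ mevalXU.
Qed.

Definition eval_row m v : 'rV[F]_#|sym_basis n m| :=
  \row_i eval v 'X_[sym_mon i].

Lemma eval_row_coords m v p : p \is m.-homog ->
  (eval_row m v *m (coords m p)^T) 0 0 = eval v p.
Proof.
move=> hp; rewrite [in RHS](homog_mon hp) /eval raddf_sum mxE.
by apply: eq_bigr => i _ /=; rewrite mevalZ !mxE mulrC.
Qed.

Lemma eval_row_sym_mx m v A :
  eval_row m v *m (sym_mx m A)^T = eval_row m (A *m v).
Proof.
apply/rowP=> i; rewrite [RHS]mxE -eval_subst -(@eval_row_coords m).
  by rewrite !mxE; apply: eq_bigr => j _; rewrite !mxE.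
exact/subst_homog/sym_mon_homog.
Qed.

End Evaluation.

Section Interpolation.

Variables (F : fieldType) (gT : finGroupType) (G : {group gT}).
Variables (V : mx_representation F G 2) (m : nat).
Variables (e a : 'rV[F]_2) (v0 : 'cV[F]_2).
(* Points are columns and linear forms are rows; a vanishes on the line of v0,
   and [aV_v0] says that the translates of v0 by g <> 1 are off that line. *)
Hypothesis eV : forall g, g \in G -> e *m V g = e.
Hypothesis e_v0 : (e *m v0) 0 0 = 1.
Hypothesis a_v0 : (a *m v0) 0 0 = 0.
Hypothesis aV_v0 : forall g, g \in G -> g != 1%g -> (a *m V g *m v0) 0 0 != 0.

Let W := dual_repr (sym_repr V m).
Let N := #|sym_basis 2 m|.
(* The inverse turns the left action on points into a right action on g. *)
Let pt g := V g^-1%g *m v0.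

Let ev g : 'rV[F]_N := eval_row m (pt g).

(** The linear form vanishing at [pt y] and at no other point of the orbit. *)
Definition root_form y : {mpoly F[2]} := lform (a *m V y).

Lemma evW x g : x \in G -> g \in G -> ev x *m W g = ev (x * g)%g.
Proof.
move=> Gx Gg; rewrite [W g]/(sym_mx m (V g^-1%g))^T eval_row_sym_mx /ev /pt.
by rewrite mulmxA -repr_mxM ?groupV // invMg.
Qed.

Lemma eval_root_form x y : x \in G -> y \in G ->
  eval (pt x) (root_form y) = (a *m V (y * x^-1)%g *m v0) 0 0.
Proof.
by move=> Gx Gy; rewrite eval_lform /pt repr_mxM ?groupV // !mulmxA.
Qed.

Lemma eval_root_form_eq0 x y : x \in G -> y \in G ->
  (eval (pt x) (root_form y) == 0) = (x == y).
Proof.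
move=> Gx Gy; rewrite eval_root_form //; have [->|neq_xy] := eqVneq x y.
  by rewrite mulgV repr_mx1 mulmx1 a_v0 eqxx.
apply: negbTE; apply: aV_v0; first by rewrite groupM ?groupV.
by rewrite -eq_mulgV1 eq_sym.
Qed.

Lemma eval_fixed x : x \in G -> eval (pt x) (lform e) = 1.
Proof.
by move=> Gx; rewrite eval_lform /pt mulmxA eV ?groupV.
Qed.

(** The Lagrange polynomial of x for the nodes in J.  Powers of the invariant
    form e, which is 1 at every node, bring the degree up to m. *)
Definition lagrange (J : {set gT}) x : {mpoly F[2]} :=
  lform e ^+ (m.+1 - #|J|) *
    \prod_(y in J :\ x) ((eval (pt x) (root_form y))^-1 *: root_form y).

Lemma prod_forms_homog (k : nat) (I : {set gT}) (c : gT -> F) :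
  lform e ^+ k * \prod_(y in I) (c y *: root_form y) \is (k + #|I|).-homog.
Proof.
apply: dhomogM; first by rewrite -[X in X.-homog]mul1n dhomogMn ?lform_homog.
rewrite -sum1_card; elim/big_rec2: _ => [|x d p _ hp]; first exact: dhomog1.
by apply: dhomogM hp; rewrite rpredZ ?lform_homog.
Qed.

Lemma lagrange_homog (J : {set gT}) x : x \in J -> (#|J| <= m.+1)%N ->
  lagrange J x \is m.-homog.
Proof.
move=> Jx leJm; have := prod_forms_homog (m.+1 - #|J|) (J :\ x)
  (fun y => (eval (pt x) (root_form y))^-1).
suff -> : (m.+1 - #|J| + #|J :\ x| = m)%N by [].
by move: leJm; rewrite (cardsD1 x J) Jx add1n subSS ltnS => /subnK.
Qed.

Lemma eval_prod_forms x k (I : {set gT}) (c : gT -> F) : x \in G ->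
  eval (pt x) (lform e ^+ k * \prod_(y in I) (c y *: root_form y))
    = \prod_(y in I) (c y * eval (pt x) (root_form y)).
Proof.
move=> Gx; rewrite /eval rmorphM rmorphXn rmorph_prod /=.
rewrite [(lform e).@[_]](eval_fixed Gx) expr1n mul1r.
by apply: eq_bigr => y _; rewrite mevalZ.
Qed.

Lemma eval_lagrange (J : {set gT}) x z : J \subset G -> x \in J -> z \in J ->
  eval (pt z) (lagrange J x) = (z == x)%:R.
Proof.
move=> sJG Jx Jz; have GJ := subsetP sJG.
rewrite eval_prod_forms ?GJ //; have [->|neq_zx] := eqVneq z x.
  apply: big1 => y /setD1P[neq_yx Jy].
  by rewrite mulVf // eval_root_form_eq0 ?GJ // eq_sym.
have zero : eval (pt z) (root_form z) = 0.
  by apply/eqP; rewrite eval_root_form_eq0 ?GJ.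
by rewrite (bigD1 z) /= ?zero ?mulr0 ?mul0r // !inE neq_zx.
Qed.

(** The pairs of nodes (x, y) and (x g, y g) have the same y x^-1, and
    hence the same normalising constants. *)
Lemma lagrangeJ (J : {set gT}) x g : J \subset G -> x \in J -> g \in G ->
  subst (V g^-1%g) (lagrange (J :* g) (x * g)%g) = lagrange J x.
Proof.
move=> sJG Jx Gg; have GJ := subsetP sJG; have Gx := GJ x Jx.
rewrite /lagrange substM subst_prod card_rcoset setD1_rcoset big_rcoset.
rewrite {1}/subst rmorphXn /= [_ \mPo _]subst_lform eV ?groupV //.
congr (_ * _); apply: eq_bigr => y /setD1P[_ /GJ Gy].
rewrite substZ subst_lform -mulmxA -repr_mxM ?groupM ?groupV // mulgK.
congr (_^-1 *: _); rewrite !eval_root_form ?groupM //.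
by rewrite invMg !mulgA mulgK.
Qed.

Let lag_col J x : 'cV[F]_N := (coords m (lagrange J x))^T.

(** The subtracted sum sends a functional on binary forms of degree m to its
    interpolation by the evaluations at the points of J. *)
Definition interp_prj (J : {set gT}) : 'M[F]_N :=
  if (#|J| <= m)%N then 1%:M - \sum_(x in J) lag_col J x *m ev x else 0.

Lemma ev_lag_col (J : {set gT}) x z : J \subset G -> (#|J| <= m.+1)%N ->
  x \in J -> z \in J -> ev z *m lag_col J x = (z == x)%:R%:M.
Proof.
move=> sJG leJm Jx Jz; rewrite [LHS]mx11_scalar eval_row_coords.
  by rewrite eval_lagrange.
exact: lagrange_homog.
Qed.

Lemma lag_colJ (J : {set gT}) x g : J \subset G -> (#|J| <= m)%N ->
  x \in J -> g \in G -> W g *m lag_col (J :* g) (x * g)%g = lag_col J x.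
Proof.
move=> sJG leJm Jx Gg; rewrite [W g]/(sym_mx m (V g^-1%g))^T -trmx_mul.
congr (_^T); apply: poly_of_inj; rewrite poly_of_sym_mx.
have leJm1 : (#|J| <= m.+1)%N by apply: leqW.
rewrite !coordsK ?lagrangeJ ?lagrange_homog //; last by rewrite card_rcoset.
by rewrite mem_rcoset mulgK.
Qed.

Lemma interp_prjJ (J : {set gT}) g : J \subset G -> g \in G ->
  interp_prj J *m W g = W g *m interp_prj (J :* g).
Proof.
move=> sJG Gg; rewrite /interp_prj card_rcoset.
case: ifP => leJm; last by rewrite mul0mx mulmx0.
rewrite mulmxBl mulmxBr mul1mx mulmx1; congr (_ - _).
rewrite big_rcoset mulmx_suml mulmx_sumr; apply: eq_bigr => x Jx.
have Gx := subsetP sJG x Jx.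
by rewrite -mulmxA evW // mulmxA lag_colJ.
Qed.

Lemma interp_prj_kill (J : {set gT}) x :
  J \subset G -> x \in J -> ev x *m interp_prj J = 0.
Proof.
move=> sJG Jx; rewrite /interp_prj; case: ifP => leJm; last exact: mulmx0.
rewrite mulmxBr mulmx1 mulmx_sumr (bigD1 x) //= big1 => [|y /andP[Jy neq_yx]].
  by rewrite mulmxA ev_lag_col ?leqW // eqxx mul1mx addr0 subrr.
by rewrite mulmxA ev_lag_col ?leqW // eq_sym (negPf neq_yx) raddf0 mul0mx.
Qed.

(** The product of the root forms of the elements of J, completed by a power of
    e, is fixed by [interp_prj J] and does not vanish at [pt x]. *)
Lemma interp_prj_live (J : {set gT}) x : J \subset G -> (#|J| <= m)%N ->
  x \in G -> x \notin J -> ev x *m interp_prj J != 0.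
Proof.
move=> sJG leJm Gx J'x; have GJ := subsetP sJG.
pose P := lform e ^+ (m - #|J|) * \prod_(y in J) (1 *: root_form y).
have hP : P \is m.-homog.
  by have := prod_forms_homog (m - #|J|) J (fun _ => 1); rewrite subnK.
pose c : 'cV[F]_N := (coords m P)^T.
have evc z : ev z *m c = (eval (pt z) P)%:M.
  by rewrite [LHS]mx11_scalar eval_row_coords.
have evP z : z \in G -> (eval (pt z) P == 0) = (z \in J).
  move=> Gz; rewrite eval_prod_forms // prodf_seq_eq0.
  apply/hasP/idP => [[y _ /andP[Jy]]|Jz].
    by rewrite mul1r eval_root_form_eq0 // ?(GJ y Jy) // => /eqP->.
  exists z; rewrite ?mem_index_enum // Jz mul1r.
  by rewrite eval_root_form_eq0 ?eqxx.
apply: contraNneq J'x => ev0; rewrite -evP //.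
have fix_c : interp_prj J *m c = c.
  rewrite /interp_prj leJm mulmxBl mul1mx mulmx_suml big1 ?subr0 // => z Jz.
  have /eqP evz : eval (pt z) P == 0 by rewrite evP ?GJ.
  by rewrite -mulmxA evc evz raddf0 mulmx0.
have := evc x; rewrite -fix_c mulmxA ev0 mul0mx => /matrixP/(_ 0 0).
by rewrite !mxE mulr1n => <-.
Qed.

Lemma interp_prj_big (J : {set gT}) :
  J \subset G -> (m < #|J|)%N -> interp_prj J = 0.
Proof. by move=> _; rewrite ltnNge /interp_prj => /negPf->. Qed.

(** The Lagrange polynomials are a one-sided inverse to the evaluations, and it
    is two-sided because binary forms of degree m have dimension m + 1. *)
Lemma interpolation (J : {set gT}) : J \subset G -> #|J| = m.+1 ->
  \sum_(x in J) lag_col J x *m ev x = 1%:M.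
Proof.
move=> sJG cJ.
pose A := \matrix_(i < N, j < #|J|) lag_col J (enum_val j) i 0.
pose B := \matrix_(j < #|J|, k < N) ev (enum_val j) 0 k.
have AB : A *m B = \sum_(x in J) lag_col J x *m ev x.
  apply/matrixP=> i k; rewrite summxE big_enum_val mxE; apply: eq_bigr => j _.
  by rewrite !mxE big_ord1 !mxE.
have leJm : (#|J| <= m.+1)%N by rewrite cJ.
have BA : B *m A = 1%:M.
  apply/matrixP=> j k.
  have /matrixP/(_ 0 0) := ev_lag_col sJG leJm (enum_valP k) (enum_valP j).
  rewrite !mxE (inj_eq enum_val_inj) mulr1n => <-.
  by apply: eq_bigr => i _; rewrite !mxE.
have /row_fullP[B' B'B] : row_full B.
  have freeB : row_free B by apply/row_freeP; exists A.
  by rewrite /row_full eqn_leq rank_leq_col (eqP freeB) cJ card_sym_basis2.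
by rewrite -AB -[A]mul1mx -B'B -(mulmxA B') BA mulmx1.
Qed.

Lemma interp_prj_span (J : {set gT}) : J \subset G ->
  exists c : gT -> 'cV[F]_N, 1%:M - interp_prj J = \sum_(x in J) c x *m ev x.
Proof.
move=> sJG; rewrite /interp_prj; case: leqP => [leJm | gtJm].
  by exists (lag_col J); rewrite opprB addrC subrK.
have [K sKJ cK] : exists2 K : {set gT}, K \subset J & #|K| = m.+1.
  have /card_geqP[s [uniq_s size_s sJ]] := gtJm.
  exists [set x in s]; first by apply/subsetP=> x; rewrite inE; apply: sJ.
  by rewrite cardsE (card_uniqP uniq_s).
exists (fun x => if x \in K then lag_col K x else 0).
rewrite subr0 -(interpolation (subset_trans sKJ sJG) cK).
rewrite [RHS](big_setID K) (setIidPr sKJ) /= [X in _ = _ + X]big1 ?addr0.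
  by apply: eq_bigr => x ->.
by move=> x /setDP[_ /negPf ->]; rewrite mul0mx.
Qed.

Lemma sym_dual_step d : (#|G| <= d)%N ->
  exists2 Q : representation F G, higman (subgroups_le G m) Q
  & mx_rsim (dadd_grepr (Representation (sym_repr W (d - #|G|))) Q)
            (sym_repr W d).
Proof.
exact: (sym_repr_step interp_prj_span interp_prj_kill interp_prj_live
  interp_prj_big evW interp_prjJ).
Qed.

End Interpolation.

(** * Periodicity *)

Lemma sym_repr_periodic (F : fieldType) (n m : nat) (gT : finGroupType)
    (G : {group gT}) (W : mx_representation F G n) r :
    (forall d, (#|G| <= d)%N ->
      exists2 Q : representation F G, higman (subgroups_le G m) Q
      & mx_rsim (dadd_grepr (Representation (sym_repr W (d - #|G|))) Q)
            (sym_repr W d)) ->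
  forall k, exists2 Q : representation F G, higman (subgroups_le G m) Q
      & mx_rsim (dadd_grepr (Representation (sym_repr W r)) Q)
            (sym_repr W (k * #|G| + r)).
Proof.
move=> step; elim=> [|k [Q higQ simQ]].
  exists grepr0; first exact: higman0.
  exact: dadd_rsim0.
have [|Q' higQ' simQ'] := step (k.+1 * #|G| + r)%N.
  by rewrite mulSn -addnA leq_addr.
rewrite mulSn -addnA addKn addnA in simQ'.
exists (dadd_grepr Q Q'); first exact: higman_dadd.
apply: mx_rsim_trans simQ'.
apply: mx_rsim_trans (mx_rsim_sym (dadd_rsimA _ _ _)) _.
exact: dadd_rsim2r.
Qed.

(** In the basis (e, a), dual to (v, w), an element g with a g v = 0 acts
    diagonally with eigenvalues 1 and c; as its order is a power of p, c = 1, so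
    that g acts trivially. *)
Lemma unipotent_frame (F : fieldType) (p : nat) (gT : finGroupType)
    (G : {group gT}) (V : mx_representation F G 2) :
    p \in [pchar F] -> p.-group G -> mx_faithful V ->
  exists (e a : 'rV[F]_2) (v0 : 'cV[F]_2),
  [/\ forall g, g \in G -> e *m V g = e, (e *m v0) 0 0 = 1, (a *m v0) 0 0 = 0 &
      forall g, g \in G -> g != 1%g -> (a *m V g *m v0) 0 0 != 0].
Proof.
move=> charF pG faithV.
have [e e_neq0 eV] : exists2 e : 'rV[F]_2, e != 0 &
    forall g, g \in G -> e *m V g = e.
  have := rfix_pgroup_pchar charF V isT pG (subxx G).
  by case/rowV0Pn=> e /rfix_mxP eV e_neq0; exists e.
have [v ev] : exists v, e *m v = 1%:M.
  by apply/row_freeP; rewrite /row_free rank_rV e_neq0.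
pose a : 'rV[F]_2 := \row_j (if j == 0 then v 1 0 else - v 0 0).
pose w : 'cV[F]_2 := \col_j (if j == 0 then e 0 1 else - e 0 0).
have mul2 (x : 'rV[F]_2) (y : 'cV[F]_2) :
    x *m y = (x 0 0 * y 0 0 + x 0 1 * y 1 0)%:M.
  rewrite [LHS]mx11_scalar mxE big_ord_recl big_ord1.
  by congr (_ + x 0 _ * y _ 0)%:M; apply: val_inj.
have ev1 : e 0 0 * v 0 0 + e 0 1 * v 1 0 = 1.
  by move/matrixP/(_ 0 0): ev; rewrite mul2 !mxE.
have av : a *m v = 0.
  by rewrite mul2 !mxE /= mulNr [v 0 0 * _]mulrC subrr raddf0.
have basis : col_mx e a *m row_mx v w = 1%:M :> 'M_(1 + 1).
  rewrite mul_col_row ev av !mul2 !mxE /= mulrN [e 0 1 * _]mulrC.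
  rewrite subrr raddf0 mulrNN [v 1 0 * _]mulrC.
  by rewrite [v 0 0 * _]mulrC addrC ev1 -scalar_mx_block.
have basis1 : v *m e + w *m a = 1%:M.
  by rewrite -mul_row_col; apply: (@mulmx1C F 2 _ _ basis).
exists e, a, v; split=> //; first by rewrite ev mxE eqxx.
  by rewrite av mxE.
move=> g Gg; apply: contraNneq => avg.
have aV : a *m V g = (a *m V g *m w) 0 0 *: a.
  rewrite -[LHS]mulmx1 -basis1 mulmxDr !mulmxA.
  rewrite [a *m _ *m v]mx11_scalar avg raddf0 mul0mx add0r.
  by rewrite {1}[a *m _ *m w]mx11_scalar mul_scalar_mx.
set c := (_ 0 0) in aV.
have aVn k : a *m V (g ^+ k)%g = c ^+ k *: a.
  elim: k => [|k IHk]; first by rewrite expg0 repr_mx1 mulmx1 expr0 scale1r.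
  by rewrite expgSr repr_mxM ?groupX // mulmxA IHk -scalemxAl aV scalerA exprSr.
have aw : (a *m w) 0 0 = 1.
  by rewrite mul2 !mxE /= mulrNN [v 1 0 * _]mulrC [v 0 0 * _]mulrC addrC mulr1n.
have c_order : c ^+ #[g] = 1.
  have := congr1 (fun x : 'rV_2 => (x *m w) 0 0) (aVn #[g]).
  by rewrite expg_order repr_mx1 mulmx1 aw -scalemxAl mxE aw mulr1.
have c1 : c = 1.
  have charg : [pchar F].-nat #[g].
    by rewrite (eq_pnat _ (pcharf_eq charF)); apply: mem_p_elt pG Gg.
  apply/eqP; rewrite -subr_eq0; have : (c - 1) ^+ #[g] == 0.
    by rewrite exprDn_pchar // exprNn_pchar // c_order expr1n subrr.
  by rewrite expf_eq0 order_gt0.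
apply/eqP; apply: (mx_faithful_inj faithV) => //.
by rewrite repr_mx1 -[V g]mul1mx -basis1 mulmxDl -!mulmxA eV // aV c1 scale1r.
Qed.

Theorem theorem1p6 (k : fieldType) (p : nat) (gT : finGroupType)
    (E : {group gT}) (q : nat) (V : mx_representation k E 2) (m d d' : nat)
    (p_prime : prime p) (char_k : p \in [pchar k])
    (abelemE : p.-abelem E) (oE : #|E| = q)
    (faithfulV : mx_faithful V) (indecV : mx_indecomposable V)
    (lt_mq : (m < q)%N) (lt_qd : (q < d)%N)
    (eq_d'd : d' = d %[mod q]) (lt_d'q : (d' < q)%N) :
  let W := dual_repr (sym_repr V m) in
  let sXE := subgroups_le_sub E m in
  exists P Q : representation k E,
    [/\ rel_projective sXE P,
        rel_projective sXE Q &
        mx_rsim (dadd_grepr (Representation (sym_repr W d)) P)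
                (dadd_grepr (Representation (sym_repr W d')) Q)].
Proof.
move=> W sXE.
have [e [a [v0 [eV e_v0 a_v0 aV_v0]]]] :=
  unipotent_frame char_k (abelem_pgroup abelemE) faithfulV.
have step := sym_dual_step m eV e_v0 a_v0 aV_v0.
have [Q higQ simQ] := sym_repr_periodic d' step (d %/ q).
exists grepr0, Q; split; first exact/higman_rel_projective/higman0.
  exact: higman_rel_projective.
apply: mx_rsim_trans (dadd_rsim0 _) _; apply: mx_rsim_sym.
suff -> : d = (d %/ q * #|E| + d')%N by [].
by rewrite oE {1}(divn_eq d q) -eq_d'd modn_small.
Qed.
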